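(* Let $c=c_{(01)^\infty}$ and $d=d_{(01)^\infty}$. (i) There exists a one-to-one group homomorphism $h_1:\mathcal{G}_{(01)^\infty}\to[[\sigma_{\{x,y\}}|\Omega(\xi_{\mathrm{pd}})]]$ such that $h_1(z)=\delta_{U_z\cap\Omega(\xi_{\mathrm{pd}});S_1}$ for all $z\in\{a,c,d\}$, where $S_1=\sigma_{\{x,y\}}|\Omega(\xi_{\mathrm{pd}})$, $U_a=[.xy]_{\{x,y\}}\cup[.xxxy]_{\{x,y\}}$, $U_c=[.y]_{\{x,y\}}$ and $U_d=[.xxy]_{\{x,y\}}$. (ii) There exists a one-to-one group homomorphism $h_2:\mathcal{G}_{(01)^\infty}\to[[\sigma_{\{0,1\}}|\Omega(\xi_{\mathrm{TM}})]]$ such that $h_2(z)=\delta_{W_z\cap\Omega(\xi_{\mathrm{TM}});S_2}$ for all $z\in\{a,c,d\}$, where $S_2=\sigma_{\{0,1\}}|\Omega(\xi_{\mathrm{TM}})$, $$W_a=[.011]_{\{0,1\}}\cup[.100]_{\{0,1\}}\cup[.01011]_{\{0,1\}}\cup[.10100]_{\{0,1\}},$$ $$W_c=[.00]_{\{0,1\}}\cup[.11]_{\{0,1\}},\qquad W_d=[.0100]_{\{0,1\}}\cup[.1011]_{\{0,1\}}.$$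
   Context: The group. Let $\mathbb{N}=\{1,2,\dots\}$. For $\omega\in\{0,1,2\}^{\mathbb{N}}$, $\mathcal{G}_\omega$ is the group of transformations of $\{0,1\}^{\mathbb{N}}$ generated by $a,b_\omega,c_\omega,d_\omega$, where $a(0\eta)=1\eta$, $a(1\eta)=0\eta$, and for all $\eta\in\{0,1\}^{\mathbb{N}}$, $l\in\{0,1,2\}$, $\omega\in\{0,1,2\}^{\mathbb{N}}$: $b_{2\omega}(0\eta)=c_{1\omega}(0\eta)=d_{0\omega}(0\eta)=0\eta$; $b_{0\omega}(0\eta)=b_{1\omega}(0\eta)=c_{0\omega}(0\eta)=c_{2\omega}(0\eta)=d_{1\omega}(0\eta)=d_{2\omega}(0\eta)=0a(\eta)$; $b_{l\omega}(1\eta)=1b_\omega(\eta)$, $c_{l\omega}(1\eta)=1c_\omega(\eta)$, $d_{l\omega}(1\eta)=1d_\omega(\eta)$. The generators are involutions and $b_\omega=c_\omega d_\omega$. Here $\omega=(01)^\infty=010101\ldots$. Subshifts. For a finite alphabet $\mathcal{A}$, $\mathcal{A}^{\mathbb{Z}}$ is the set of bi-infinite strings $\ldots x_{-1}x_0.x_1x_2\ldots$ with the product topology; the shift $\sigma_{\mathcal{A}}$ is given by $(\sigma_{\mathcal{A}}(\omega))(n)=\omega(n+1)$. For $\xi\in\mathcal{A}^{\mathbb{N}}$, $\Omega(\xi)$ is the set of all $\omega\in\mathcal{A}^{\mathbb{Z}}$ such that every (finite, nonempty, contiguous) subword of $\omega$ is a subword of $\xi$; it is closed and $\sigma_{\mathcal{A}}$-invariant,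 and $\sigma_{\mathcal{A}}|\Omega(\xi)$ is the restriction of the shift. $\xi_{\mathrm{TM}}\in\{0,1\}^{\mathbb{N}}$ is the unique infinite string beginning with $0$ preserved by the substitution $0\to01$, $1\to10$; $\xi_{\mathrm{pd}}\in\{x,y\}^{\mathbb{N}}$ is the unique infinite string beginning with $x$ preserved by the substitution $x\to xy$, $y\to xx$. $\Omega(\xi_{\mathrm{TM}})$ and $\Omega(\xi_{\mathrm{pd}})$ are Cantor sets. For a nonempty word $w$ of length $n$ over $\mathcal{A}$, $[.w]_{\mathcal{A}}$ is the set of all $\ldots x_{-1}x_0.x_1x_2\ldots\in\mathcal{A}^{\mathbb{Z}}$ with $x_1x_2\ldots x_n=w$. For a homeomorphism $T:X\to X$ of a Cantor set, the topological full group $[[T]]$ is the group of all homeomorphisms $F:X\to X$ of the form $F(x)=T^{\nu(x)}(x)$ with $\nu:X\to\mathbb{Z}$ continuous. For a clopen set $U\subset X$ with $T(U)\cap U=\varnothing$, the generalized $2$-cycle $\delta_{U;T}:X\to X$ is given by $\delta_{U;T}(x)=T(x)$ if $x\in U$, $\delta_{U;T}(x)=T^{-1}(x)$ if $x\in T(U)$, and $\delta_{U;T}(x)=x$ otherwise; it is an element of $[[T]]$. *)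

(* Defs.v *)
From HB Require Import structures.
From mathcomp Require Import all_boot all_order all_algebra.
From mathcomp Require Import all_classical.
From mathcomp Require Import topology.

Set Implicit Arguments.
Unset Strict Implicit.
Unset Printing Implicit Defensive.

Import GRing.Theory.
Local Open Scope classical_set_scope.
Local Open Scope ring_scope.

(** MathComp's {perm T} requires a finite T; [sym T] is the group of all
    self-bijections of an arbitrary type, with f * g := f \o g. *)

Record sym (T : Type) := Sym {
  sym_fun :> T -> T;
  sym_inv : T -> T;
  sym_funK : cancel sym_fun sym_inv;
  sym_invK : cancel sym_inv sym_fun }.

HB.instance Definition _ (T : Type) := gen_eqMixin (sym T).
HB.instance Definition _ (T : Type) := gen_choiceMixin (sym T).

Section SymGroup.
Variable T : Type.
Implicit Types f g : sym T.

Lemma sym_ext f g : f =1 g -> f = g.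
Proof.
case: f g => [f f' fK f'K] [g g' gK g'K] /= fg.
have efg : f = g by exact/funext.
subst g; have efg' : f' = g' by apply/funext => x; rewrite -{1}[x]g'K fK.
by subst g'; congr Sym; exact: Prop_irrelevance.
Qed.

Definition sym_one : sym T := @Sym T id id (frefl _) (frefl _).
Definition sym_opp f : sym T := Sym (@sym_invK T f) (@sym_funK T f).
Definition sym_mul f g : sym T :=
  Sym (can_comp (@sym_funK T f) (@sym_funK T g))
      (can_comp (@sym_invK T g) (@sym_invK T f)).

Lemma sym_mulA : associative sym_mul.
Proof. by move=> f g h; exact: sym_ext. Qed.
Lemma sym_mul1 : left_id sym_one sym_mul.
Proof. by move=> f; exact: sym_ext. Qed.
Lemma sym_mulr1 : right_id sym_one sym_mul.
Proof. by move=> f; exact: sym_ext. Qed.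
Lemma sym_mulV : left_inverse sym_one sym_opp sym_mul.
Proof. by move=> f; apply: sym_ext => x /=; rewrite sym_funK. Qed.
Lemma sym_mulrV : right_inverse sym_one sym_opp sym_mul.
Proof. by move=> f; apply: sym_ext => x /=; rewrite sym_invK. Qed.

HB.instance Definition _ := isGroup.Build (sym T)
  sym_mulA sym_mul1 sym_mulr1 sym_mulV sym_mulrV.

Lemma sym_fun1 x : (1%g : sym T) x = x. Proof. by []. Qed.
Lemma sym_funM f g x : (f * g)%g x = f (g x). Proof. by []. Qed.
Lemma sym_funV f x : (f^-1)%g x = sym_inv f x. Proof. by []. Qed.

Definition sym_of_involution (f : T -> T) (fK : involutive f) : sym T :=
  Sym fK fK.

End SymGroup.

Definition zexpg (G : groupType) (g : G) (z : int) : G :=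
  match z with Posz n => (g ^+ n)%g | Negz n => (g ^- n.+1)%g end.

Section Zexpg.
Variables (G : groupType) (g : G).

Lemma zexpgS z : zexpg g (z + 1) = (g * zexpg g z)%g.
Proof.
case: z => [n|[|n]]; first by rewrite -PoszD addn1 /= expgS.
  by rewrite /= divgg.
have -> : Negz n.+1 + 1 = Negz n by rewrite !NegzE -addn1 PoszD opprD addrNK.
by rewrite /= [in RHS]expgSr invgM mulgA divgg mul1g.
Qed.

Lemma zexpgD z t : zexpg g (z + t) = (zexpg g z * zexpg g t)%g.
Proof.
elim: z => [|n IH|n IH]; first by rewrite add0r /= mul1g.
  by rewrite -addn1 PoszD addrAC !zexpgS IH mulgA.
apply: (@mulgI _ g); rewrite mulgA -!zexpgS.
by rewrite -addn1 PoszD opprD addrAC !addrNK.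
Qed.

Lemma zexpgN z : zexpg g (- z) = (zexpg g z)^-1%g.
Proof. by apply: (@mulIg _ (zexpg g z)); rewrite -zexpgD addNr mulVg. Qed.

End Zexpg.

Section Generated.
Variables (G : groupType) (S : set G).

Definition in_generated : {pred G} := fun g =>
  `[< forall H : {pred G}, group_closed H -> {in S, forall s, s \in H} ->
      g \in H >].

Lemma in_generated_closed : group_closed in_generated.
Proof.
split=> [|g h]; first by apply/asboolP => H [].
move=> /asboolP gS /asboolP hS; apply/asboolP => H HG HS.
by apply: HG.2; [exact: gS|exact: hS].
Qed.

Lemma mem_generated s : S s -> in_generated s.
Proof. by move=> Ss; apply/asboolP => H _; apply; exact/mem_set. Qed.

Definition generated := {g : G | in_generated g}.

Definition generator s (Ss : S s) : generated := exist _ s (mem_generated Ss).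

HB.instance Definition _ := SubChoice.on generated.
HB.instance Definition _ :=
  SubChoice_isSubGroup.Build G in_generated generated in_generated_closed.

End Generated.

(** Infinite sequences are indexed from 0: the first letter of [eta] is
    [eta 0]. *)

Definition binseq := nat -> bool.

Definition tail (T : Type) (u : nat -> T) : nat -> T := fun n => u n.+1.

Definition flip (eta : binseq) : binseq :=
  fun n => if n is 0 then ~~ eta 0%N else eta n.

(** The transformations b, c, d have the same recursive description, except for
    the letter l of omega at which they act trivially on 0 eta: it is 2 for b,
    1 for c and 0 for d.  See [spinal0] and [spinal1]. *)

Fixpoint spinal (l : 'I_3) (omega : nat -> 'I_3) (eta : binseq) (n : nat)
    {struct n} : bool :=
  if n is m.+1 then
    if eta 0%N then spinal l (tail omega) (tail eta) m
    else if omega 0%N == l then eta n else flip (tail eta) m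
  else eta 0%N.

Definition scons (T : Type) (t : T) (u : nat -> T) : nat -> T :=
  fun n => if n is m.+1 then u m else t.

Lemma flip_scons b eta : flip (scons b eta) = scons (~~ b) eta.
Proof. by apply/funext => -[]. Qed.

Lemma spinal0 l k omega eta :
  spinal l (scons k omega) (scons false eta) =
  scons false (if k == l then eta else flip eta).
Proof. by apply/funext => -[|n] //=; case: ifP. Qed.

Lemma spinal1 l k omega eta :
  spinal l (scons k omega) (scons true eta) = scons true (spinal l omega eta).
Proof. by apply/funext => -[]. Qed.

Lemma flipK : involutive flip.
Proof. by move=> eta; apply/funext => -[|n] //=; rewrite negbK. Qed.

Lemma spinalK l omega : involutive (spinal l omega).
Proof.
move=> eta; apply/funext => n; elim: n omega eta => [//|n IH] omega eta /=.
case: ifP => e0.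
  rewrite -[RHS](IH (tail omega) (tail eta)); congr (spinal _ _ _ n).
  by apply/funext => m; rewrite /tail /= e0.
by case: n {IH} => [|n]; case: ifP => o0 /=;
  rewrite /tail /= ?e0 ?o0 /= ?negbK.
Qed.

Definition gen_a : sym binseq := sym_of_involution flipK.
Definition gen_b omega : sym binseq := sym_of_involution (spinalK 2 omega).
Definition gen_c omega : sym binseq := sym_of_involution (spinalK 1 omega).
Definition gen_d omega : sym binseq := sym_of_involution (spinalK 0 omega).

Definition grig_gens (omega : nat -> 'I_3) : set (sym binseq) :=
  [set gen_a; gen_b omega; gen_c omega; gen_d omega].

Definition grig omega := generated (grig_gens omega).
HB.instance Definition _ omega := Group.on (grig omega).

Section Generators.
Variable omega : nat -> 'I_3.

Lemma grig_gens_a : grig_gens omega gen_a.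
Proof. by do 3!left. Qed.
Lemma grig_gens_c : grig_gens omega (gen_c omega).
Proof. by left; right. Qed.
Lemma grig_gens_d : grig_gens omega (gen_d omega).
Proof. by right. Qed.

Definition grig_a : grig omega := generator grig_gens_a.
Definition grig_c : grig omega := generator grig_gens_c.
Definition grig_d : grig omega := generator grig_gens_d.

End Generators.

Definition omega01 : nat -> 'I_3 := fun n => if odd n then 1 else 0.

Definition homeomorphism (X : topologicalType) (F : sym X) : Prop :=
  continuous F /\ continuous (sym_inv F).

Section FullGroup.
Variables (X : topologicalType) (T : sym X).

Definition in_full_group : {pred sym X} := fun F =>
  `[< homeomorphism F /\
      exists2 nu : X -> discrete_topology int,
        continuous nu & forall x, F x = zexpg T (nu x) x >].

Lemma continuous_discreteP (D : choiceType) (f : X -> discrete_topology D) :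
  continuous f <-> forall x, \forall y \near x, f y = f x.
Proof.
split=> fc x; first exact: (fc x _ (discrete_set1 (f x : discrete_topology D))).
move=> U fU; have Ufx : U (f x) by exact: nbhs_singleton.
by apply: filterS (fc x) => y /= ->.
Qed.

Lemma in_full_group_closed : group_closed in_full_group.
Proof.
split.
  apply/asboolP; split; first by split=> x A.
  exists (fun=> 0); last by [].
  by apply/continuous_discreteP => x; apply: nearW.
move=> F H /asboolP[[cF cF'] [nu /continuous_discreteP cnu nuE]].
move=> /asboolP[[cH cH'] [mu /continuous_discreteP cmu muE]].
apply/asboolP; split.
  split=> x; first exact: (continuous_comp (cH' x) (cF _)).
  exact: (continuous_comp (cF' x) (cH _)).
exists (fun x => nu (sym_inv H x) - mu (sym_inv H x)).
  apply/continuous_discreteP => x.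
  have Hnu : \forall y \near x, nu (sym_inv H y) = nu (sym_inv H x).
    exact: cH' (cnu _).
  have Hmu : \forall y \near x, mu (sym_inv H y) = mu (sym_inv H x).
    exact: cH' (cmu _).
  by move: Hnu Hmu; apply: filterS2 => y /= -> ->.
move=> x; rewrite sym_funM sym_funV nuE zexpgD sym_funM zexpgN.
congr (sym_fun _ _); set y := sym_inv H x.
by rewrite -[x in RHS](sym_invK H) -/y muE sym_funV sym_funK.
Qed.

Definition full_group := {F : sym X | in_full_group F}.

HB.instance Definition _ := SubChoice.on full_group.
HB.instance Definition _ :=
  SubChoice_isSubGroup.Build (sym X) in_full_group full_group
    in_full_group_closed.

(** The generalized 2-cycle [two_cycle U] is only meaningful for those [U]
    satisfying [two_cycle_dom U]. *)

Definition two_cycle_dom (U : set X) : Prop :=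
  clopen U /\ (T @` U) `&` U = set0.

Definition two_cycle (U : set X) (x : X) : X :=
  if x \in U then T x else if x \in T @` U then sym_inv T x else x.

Definition is_two_cycle (U : set X) (F : full_group) : Prop :=
  two_cycle_dom U /\ forall x, val F x = two_cycle U x.

End FullGroup.

Section Subshift.
Variable A : finType.

Definition fullshift := {ptws int -> discrete_topology A}.
HB.instance Definition _ := Topological.on fullshift.

Definition subword_nat (w : seq A) (xi : nat -> A) : Prop :=
  exists k : nat, w = mkseq (fun i => xi (k + i)%N) (size w).

Definition subword_int (w : seq A) (s : fullshift) : Prop :=
  exists k : int, w = mkseq (fun i : nat => s (k + i%:Z)) (size w).

Definition Omega (xi : nat -> A) : set fullshift :=
  [set s | forall w, w != [::] -> subword_int w s -> subword_nat w xi].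

(** x_1 x_2 ... x_n = w; the letter x_0, just before the dot, is free. *)
Definition cylinder (w : seq A) : set fullshift :=
  [set s | w = mkseq (fun i : nat => s (i.+1)%:Z) (size w)].

Definition translate (k : int) (s : fullshift) : fullshift :=
  fun n => s (n + k).

Lemma translate_continuous k : continuous (translate k).
Proof.
move=> s; have F := fmap_filter (translate k) (nbhs_filter s).
apply/cvg_sup => n.
apply: (@continuous_comp_initial fullshift fullshift (discrete_topology A)
  (fun f => f n) (translate k)).
exact: (@proj_continuous _ (fun=> discrete_topology A) (n + k)).
Qed.

Section Omega.
Variable xi : nat -> A.

Lemma Omega_translate k s : Omega xi s -> Omega xi (translate k s).
Proof.
move=> xs w w0 [i wE]; apply: xs => //; exists (i + k).
rewrite [LHS]wE; apply: eq_mkseq => j.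
by rewrite /translate addrAC.
Qed.

Definition translateO (k : int) (s : Omega xi) : Omega xi :=
  exist _ (translate k (set_val s)) (mem_set (Omega_translate (set_valP s))).

Lemma translateOK (k l : int) : k + l = 0 -> cancel (translateO k) (translateO l).
Proof.
move=> kl s; apply: val_inj; apply/funext => n /=.
rewrite -[LHS]/(set_val s (n + l + k)) -addrA [l + k]addrC kl addr0.
by rewrite set_valE.
Qed.

Definition Omega_shift : sym (Omega xi) :=
  Sym (translateOK (subrr 1)) (translateOK (addNr 1)).

Lemma translateO_continuous k : continuous (translateO k).
Proof.
apply: (@continuous_comp_initial (Omega xi) (Omega xi) fullshift set_val).
move=> s; apply: (@continuous_comp _ _ _ set_val (translate k)).
  exact: initial_continuous.
exact: translate_continuous.
Qed.

Lemma Omega_shift_homeomorphism : homeomorphism Omega_shift.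
Proof. by split; exact: translateO_continuous. Qed.

End Omega.

(** [subst tau u] is the image of the infinite word [u] under a substitution
    [tau] replacing every letter by a word of length 2. *)
Definition subst (tau : A -> A * A) (u : nat -> A) : nat -> A :=
  fun n => if odd n then (tau (u n./2)).2 else (tau (u n./2)).1.

(** The fixed point of [tau] beginning with [t], when [tau t] begins with [t]:
    the limit of [tau^k(ttt...)]. *)
Definition subst_fix (tau : A -> A * A) (t : A) : nat -> A :=
  fun n => iter n (subst tau) (fun=> t) n.

Lemma subst_iter tau t (u v : nat -> A) k n : (tau t).1 = t ->
  u 0%N = t -> v 0%N = t -> (n <= k)%N ->
  iter k (subst tau) u n = iter k (subst tau) v n.
Proof.
move=> tauE; elim: k n u v => [|k IH] n u v u0 v0.
  by rewrite leqn0 => /eqP->; rewrite /= u0 v0.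
rewrite !iterS /subst => nk.
have n2 : (n./2 <= k)%N.
  by rewrite leq_half_double (leq_trans nk) // ltnS -addnn leq_addr.
by rewrite (IH n./2 u v).
Qed.

Lemma subst_fixP tau t : (tau t).1 = t ->
  unique (fun u => u 0%N = t /\ subst tau u = u) (subst_fix tau t).
Proof.
move=> tauE; have sfE k n : (n <= k)%N ->
    subst_fix tau t n = iter k (subst tau) (fun=> t) n.
  move=> nk; have it0 j : iter j (subst tau) (fun=> t) 0%N = t.
    by elim: j => //= j IH; rewrite /subst /= IH.
  by rewrite -(subnKC nk) iterD; exact: (@subst_iter _ t).
split.
  split=> //; apply/funext => n; rewrite (sfE n.+1 n) // iterS /subst.
  by rewrite !(sfE n n./2) // leq_half_double -addnn -addnS leq_addr.
move=> u [u0 uE]; apply/funext => n; rewrite (sfE n n)//.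
have -> : u n = iter n (subst tau) u n.
  by congr (_ n); elim: n => //= n <-.
exact: (@subst_iter _ t).
Qed.

End Subshift.

Definition tau_TM (t : bool) : bool * bool :=
  if t then (true, false) else (false, true).
Definition xi_TM : nat -> bool := subst_fix tau_TM false.

Lemma xi_TMP : unique (fun u => u 0%N = false /\ subst tau_TM u = u) xi_TM.
Proof. exact: subst_fixP. Qed.

Variant letter := lx | ly.

Definition bool_of_letter (t : letter) : bool := if t is lx then false else true.
Definition letter_of_bool (b : bool) : letter := if b then ly else lx.
Lemma bool_of_letterK : cancel bool_of_letter letter_of_bool.
Proof. by case. Qed.
HB.instance Definition _ := Finite.copy letter (can_type bool_of_letterK).

Definition tau_pd (t : letter) : letter * letter :=
  if t is lx then (lx, ly) else (lx, lx).
Definition xi_pd : nat -> letter := subst_fix tau_pd lx.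

Lemma xi_pdP : unique (fun u => u 0%N = lx /\ subst tau_pd u = u) xi_pd.
Proof. exact: subst_fixP. Qed.

(* Main.v *)
(** The points of the orbit of 111... form a half-line on which a, c, d act by
    exchanging the ends of the edges they label, and the sequence of labels is
    read off from the period doubling word: even positions are a, odd positions
    are c at the letter y and d at the letter x.  On a two-sided sequence with
    these labels, the 2-cycles of the theorem move the dot along the line in the
    same way.  A word acts on a vertex through the labels in a bounded window
    only, and the windows occurring in both situations are the same; since the
    orbit of 111... is dense and the period doubling word is not periodic, a
    word in a, c, d is trivial in the Grigorchuk group if and only if it is
    trivial in the topological full group.  For the Thue-Morse subshift, the
    labels are those of the difference sequence (equal adjacent letters give y,
    distinct ones give x), which belongs to the period doubling subshift. *)

From HB Require Import structures.
Require Import Defs.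
From mathcomp Require Import all_boot all_order all_algebra.
From mathcomp Require Import all_classical.
From mathcomp Require Import topology.
From mathcomp Require Import zify.

Set Implicit Arguments.
Unset Strict Implicit.
Unset Printing Implicit Defensive.

Import GRing.Theory.
Local Open Scope classical_set_scope.

(** * The Thue-Morse and period doubling words *)

Lemma subst_double (A : finType) (tau : A -> A * A) (u : nat -> A) n :
  subst tau u = u -> u n.*2 = (tau (u n)).1 /\ u n.*2.+1 = (tau (u n)).2.
Proof.
by move=> e; rewrite -{1 3}e /subst /= odd_double doubleK /= uphalf_double.
Qed.

Lemma xi_TM_double n : xi_TM n.*2 = xi_TM n.
Proof.
have [[_ /(subst_double n)[-> _]] _] := xi_TMP.
by case: (xi_TM n).
Qed.

Lemma xi_TM_doubleS n : xi_TM n.*2.+1 = ~~ xi_TM n.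
Proof.
have [[_ /(subst_double n)[_ ->]] _] := xi_TMP.
by case: (xi_TM n).
Qed.

Lemma xi_TM0 : xi_TM 0 = false.
Proof. by have [[]] := xi_TMP. Qed.

Lemma xi_pd_double n : xi_pd n.*2 = lx.
Proof.
have [[_ /(subst_double n)[-> _]] _] := xi_pdP.
by case: (xi_pd n).
Qed.

Lemma xi_pd_doubleS n : xi_pd n.*2.+1 = if xi_pd n == lx then ly else lx.
Proof.
have [[_ /(subst_double n)[_ ->]] _] := xi_pdP.
by case: (xi_pd n).
Qed.

Lemma nat_parity n : {k | n = k.*2} + {k | n = k.*2.+1}.
Proof.
case o : (odd n); [right|left]; exists n./2; lia.
Qed.

Lemma xi_pd_even n : ~~ odd n -> xi_pd n = lx.
Proof. by case: (nat_parity n) => -[k ->]; rewrite /= ?xi_pd_double ?odd_double. Qed.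

Lemma xi_pd_odd n : odd n -> xi_pd n = if xi_pd n./2 == lx then ly else lx.
Proof.
case: (nat_parity n) => -[k ->]; rewrite /= odd_double //.
by rewrite uphalf_double xi_pd_doubleS.
Qed.

(** Letters at odd positions complement those at the halved positions, and one of two adjacent
    halves is even, hence carries x. *)
Lemma xi_pd_odd_consecutive n : odd n -> xi_pd n = lx -> xi_pd n.+2 = ly.
Proof.
move=> on; rewrite xi_pd_odd //; case: ifP => // xk _.
rewrite xi_pd_odd /=; last by rewrite negbK.
rewrite xi_pd_even //=; apply/negP => ok.
by move/eqP: xk; rewrite xi_pd_even.
Qed.

Lemma xi_pd_TM n : xi_pd n = if xi_TM n != xi_TM n.+1 then lx else ly.
Proof.
elim/ltn_ind: n => n IH; case: (nat_parity n) => -[k en]; rewrite en.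
  by rewrite xi_pd_double xi_TM_double xi_TM_doubleS; case: xi_TM.
rewrite xi_pd_doubleS -doubleS xi_TM_double xi_TM_doubleS IH; last by lia.
by case: (xi_TM k); case: (xi_TM k.+1).
Qed.

(** Descent on the period: the odd positions turn an even period into its half, while an odd period
    would copy the x of the even positions to two consecutive odd ones. *)
Lemma xi_pd_aperiodic p N : (forall n, N <= n -> xi_pd (n + p) = xi_pd n) -> p = 0.
Proof.
elim/ltn_ind: p N => p IH N per; case: (nat_parity p) => -[q ep].
  case: (posnP q) => [q0|q0]; first by rewrite ep q0.
  have : q = 0 by apply: (IH q _ N) => [|n Nn]; [lia|have := per n.*2.+1;
    rewrite ep addSn -doubleD !xi_pd_doubleS => /(_ ltac:(lia));
    case: (xi_pd n); case: (xi_pd (n + q))].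
  by lia.
have e n : N <= n.*2 -> xi_pd (n.*2 + p) = lx.
  by move=> /per ->; rewrite xi_pd_double.
have := @xi_pd_odd_consecutive (N.*2 + p); rewrite e; last by lia.
have -> : (N.*2 + p).+2 = N.+1.*2 + p by lia.
by rewrite e; [rewrite ep oddD /= !odd_double => /(_ erefl erefl)|lia].
Qed.

(** * The labelled half-line and the action of a, c, d on it *)

Variant gen := ga | gc | gd.

(* Position n of a sequence is viewed as an edge of a line, labelled by the
   generator that exchanges its two ends; [edge z u] tests whether z labels the
   edge at the first letter of u. *)
Definition edge (z : gen) (u : nat -> letter) : bool :=
  match z with
  | ga => (u 0 == lx) && (u 1 == ly) ||
          [&& u 0 == lx, u 1 == lx, u 2 == lx & u 3 == ly]
  | gc => u 0 == ly
  | gd => [&& u 0 == lx, u 1 == lx & u 2 == ly]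
  end.

(** For even n the letter y stands at n + 1 or, failing that, at n + 3: these are the two words
    tested for [ga]. For odd n carrying x, the same fact puts at n + 2 the y required by [gd]. *)
Lemma edge_xi_pd z n : edge z (fun i => xi_pd (n + i)) =
  match z with
  | ga => ~~ odd n
  | gc => odd n && (xi_pd n == ly)
  | gd => odd n && (xi_pd n == lx)
  end.
Proof.
rewrite /edge addn0 addn1 addn2 addn3.
case: (boolP (odd n)) => [on|en]; last first.
  rewrite [xi_pd n]xi_pd_even // [xi_pd n.+2]xi_pd_even /= ?negbK //.
  case: z => //; last by rewrite andbF.
  have := @xi_pd_odd_consecutive n.+1; rewrite /= en.
  by case: (xi_pd n.+1) => // -> .
rewrite [xi_pd n.+1]xi_pd_even /= ?negbK //.
rewrite [xi_pd n.+3]xi_pd_even /= ?negbK //.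
case: z => //=; first by rewrite !andbF.
have := xi_pd_odd_consecutive on.
by case: (xi_pd n) => // -> .
Qed.

(* [gray n] is the n-th vertex, counted from the end 111..., of the half-line
   formed by the orbit of 111...; the digits follow a Gray code. *)
Definition gray (n : nat) : binseq :=
  fun k => odd (iter k half n) == odd (iter k half n)./2.

Lemma tail_gray n : tail (gray n) = gray n./2.
Proof. by apply/funext => k; rewrite /tail /gray iterSr. Qed.

Lemma gray_head n : gray n 0 = (odd n == odd n./2). Proof. by []. Qed.

Lemma binseq_ext (u v : binseq) : u 0 = v 0 -> tail u = tail v -> u = v.
Proof.
by move=> e0 e; apply/funext => -[|k] //; have := congr1 (@^~ k) e.
Qed.

Lemma gray_inj : injective gray.
Proof.
suff H N n m : n <= N -> m <= N -> gray n = gray m -> n = m.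
  by move=> n m; apply: (H (n + m)); lia.
elim: N n m => [|N IH] n m; first by lia.
move=> nN mN e.
have e2 : n./2 = m./2.
  by apply: IH; [lia|lia|rewrite -!tail_gray e].
have : gray n 0 = gray m 0 by rewrite e.
rewrite !gray_head e2 => oE; rewrite -[n]odd_double_half -[m]odd_double_half e2.
by move: oE; case: (odd n); case: (odd m); case: (odd _).
Qed.

(** Once the higher bits of the index fit the tail, its lowest bit is free to set the head digit.
    The bound [K] serves to keep whole windows inside the half-line. *)
Lemma gray_dense (u : binseq) K m :
  exists2 n, K <= n & forall k, k < m -> gray n k = u k.
Proof.
elim: m u => [|m IH] u; first by exists K.
have [n Kn nu] := IH (tail u).
exists (n.*2 + (odd n == u 0)); first by lia.
have half : (n.*2 + (odd n == u 0))./2 = n by lia.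
case=> [|k] km; last by rewrite -[LHS]/(tail (gray _) k) tail_gray half nu.
by rewrite gray_head half oddD odd_double; case: (odd n); case: (u 0).
Qed.

Definition step_nat (P : nat -> bool) (n : nat) : nat :=
  if P n then n.+1 else if (0 < n) && P n.-1 then n.-1 else n.

Lemma flip_gray n : flip (gray n) = gray (step_nat (fun n => ~~ odd n) n).
Proof.
rewrite /step_nat; case: (nat_parity n) => -[k ->] /=;
  rewrite odd_double /=; apply: binseq_ext; rewrite /flip.
- by rewrite !gray_head /= odd_double uphalf_double doubleK; case: odd.
- by rewrite -[LHS]/(tail (gray _)) !tail_gray doubleK /= uphalf_double.
- by rewrite !gray_head /= odd_double uphalf_double doubleK; case: odd.
- by rewrite -[LHS]/(tail (gray _)) !tail_gray doubleK /= uphalf_double.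
Qed.

(** [tail] exchanges the two phases of 0101..., so an induction on digits needs both. *)
Definition alternating (p : bool) : nat -> 'I_3 :=
  fun n => (if odd n (+) p then 1 else 0)%R.

Lemma tail_alternating p : tail (alternating p) = alternating (~~ p).
Proof. by apply/funext => k; rewrite /tail /alternating /= addbN addNb. Qed.

Lemma tail_spinal l omega eta : tail (spinal l omega eta) =
  if eta 0 then spinal l (tail omega) (tail eta)
  else if omega 0 == l then tail eta else flip (tail eta).
Proof. by apply/funext => n; rewrite /tail /=; case: (eta 0) => //; case: eqP. Qed.

(** [q] chooses between c and d. Dropping the first digit halves the vertex and changes the phase,
    while the letter of [xi_pd] at an odd position complements the one at its half; the two
    recursions match. *)
Lemma spinal_gray p q n :
  spinal (if q then 1 else 0)%R (alternating p) (gray n) =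
  gray (step_nat (fun n => odd n && (xi_pd n == if p == q then lx else ly)) n).
Proof.
elim/ltn_ind: n p => n IH p.
set P := fun n => _.
have altT := tail_alternating p.
have alt0 : (alternating p 0 == (if q then 1 else 0)%R) = (p == q).
  by rewrite /alternating /=; case: p {P altT}; case: q {IH}.
(* Vertex 0 is 111..., fixed by c and d; halving does not decrease it, so it is treated apart. *)
case: (posnP n) => [n0|n_gt0].
  rewrite n0 /step_nat /=; apply: funext => k.
  elim: k (alternating p) => [//|k IHk] om /=.
  by rewrite tail_gray IHk -[RHS]/(tail (gray 0) k) tail_gray.
move: {IH}(IH n./2 ltac:(lia) (~~ p)).
set P' := fun n => _ => IH.
have Pd k : P k.*2 = false by rewrite /P odd_double.
(* For odd k the first digit at both ends of the edge is 1, and the edge is copied from the halved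
   line; for even k it is 0, and the edge is that of a flip, present exactly when p and q differ. *)
have PS k : P k.*2.+1 = if odd k then P' k else p != q.
  rewrite /P /P' xi_pd_doubleS /= odd_double /=.
  case: (boolP (odd k)) => [_|/xi_pd_even->] /=; last by case: (p); case: (q).
  by case: (p); case: (q); case: (xi_pd k).
have P'e k : ~~ odd k -> P' k = false by rewrite /P' => /negbTE->.
clearbody P P'; rewrite /step_nat in IH *.
apply: binseq_ext; first rewrite [LHS]gray_head gray_head;
  last rewrite tail_spinal altT alt0 tail_gray IH tail_gray gray_head flip_gray
               /step_nat.
all: case: (nat_parity n) n_gt0 => -[k ->] kp;
  rewrite ?Pd ?PS /= ?odd_double /= ?uphalf_double ?doubleK.
- case: k kp => // k _; rewrite doubleS /= PS.
  by case: (boolP (odd k)) => ok; case: ifP => _ /=; lia.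
- by case: (boolP (odd k)) => ok; case: ifP => _ /=; lia.
- case: k kp => // k _; rewrite doubleS /= PS.
  case: (boolP (odd k)) => ok /=.
    by rewrite P'e /= ?negbK //; case: (P' k); rewrite /= ?uphalf_double ?doubleK.
  by case: (p == q); rewrite /= ?uphalf_double ?doubleK.
- case: (boolP (odd k)) => ok /=.
    rewrite [P' k.-1]P'e ?andbF; last by lia.
    by case: (P' k); rewrite /= ?uphalf_double ?doubleK.
  by case: (p == q); rewrite /= ?uphalf_double ?doubleK.
Qed.

Lemma omega01_alternating : omega01 = alternating false.
Proof. by apply/funext => n; rewrite /omega01 /alternating addbF. Qed.

(** The letter 2 does not occur in the sequence, so past the first 0 b always flips, and exactly one
    of c and d does. *)
Lemma spinal_cd p eta : spinal 2%R (alternating p) eta =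
  spinal 1%R (alternating p) (spinal 0%R (alternating p) eta).
Proof.
apply/funext => k; elim: k p eta => [//|k IH] p eta.
rewrite -![spinal _ _ _ k.+1]/(tail (spinal _ _ _) k) !tail_spinal.
rewrite -[spinal _ _ _ 0]/(eta 0) tail_alternating; case: ifP => _.
  exact: IH.
by rewrite /alternating; case: p.
Qed.

Lemma gen_bE : gen_b omega01 = (gen_c omega01 * gen_d omega01)%g.
Proof.
by apply: sym_ext => eta; rewrite sym_funM /= omega01_alternating spinal_cd.
Qed.

Definition grig_sym (z : gen) : sym binseq :=
  match z with
  | ga => gen_a
  | gc => gen_c omega01
  | gd => gen_d omega01
  end.

Lemma grig_sym_gray z n : grig_sym z (gray n) =
  gray (step_nat (fun n => edge z (fun i => xi_pd (n + i))) n).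
Proof.
have -> := funext (edge_xi_pd z).
case: z => /=; first exact: flip_gray.
  by rewrite omega01_alternating (spinal_gray false true).
by rewrite omega01_alternating (spinal_gray false false).
Qed.

(** This is the action on the levels of the binary tree; with [gray_dense] it carries triviality
    from the vertices [gray n] to all sequences. *)
Lemma spinal_prefix l omega m (u v : binseq) :
  (forall k, k < m -> u k = v k) ->
  forall k, k < m -> spinal l omega u k = spinal l omega v k.
Proof.
elim: m omega u v => [//|m IH] omega u v uv [|k] km; first by rewrite /= uv.
rewrite -![spinal _ _ _ k.+1]/(tail (spinal _ _ _) k) !tail_spinal uv //.
have uvt i : i < m -> tail u i = tail v i by move=> im; apply: uv.
case: (v 0); first exact: IH.
case: eqP => _; first exact: uvt.
by case: k km => [|k] km; rewrite /= uvt.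
Qed.

Lemma grig_sym_prefix z m (u v : binseq) :
  (forall k, k < m -> u k = v k) ->
  forall k, k < m -> grig_sym z u k = grig_sym z v k.
Proof.
case: z => uv; [|exact: spinal_prefix..].
by case=> [|k] km /=; rewrite uv.
Qed.

(** * Words in the generators *)

Section Words.
Variable G : groupType.

Definition word_val (g : gen -> G) (w : seq gen) : G :=
  foldr (fun z x => g z * x)%g 1%g w.

Lemma word_val_cat g w w' :
  word_val g (w ++ w') = (word_val g w * word_val g w')%g.
Proof. by elim: w => [|z w IH] /=; rewrite ?mul1g // IH mulgA. Qed.

Lemma word_val_rev g w : (forall z, (g z * g z = 1)%g) ->
  word_val g (rev w) = ((word_val g w)^-1)%g.
Proof.
move=> gK; have gV z : ((g z)^-1 = g z)%g.
  by apply: (@mulgI _ (g z)); rewrite divgg.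
elim: w => [|z w IH] /=; first by rewrite invg1.
by rewrite rev_cons -cats1 word_val_cat IH invgM /= mulg1 gV.
Qed.

End Words.

Lemma val_word_val (G : groupType) (S : {pred G}) (H : subGroupType S) g w :
  val (word_val g w : H) = word_val (val \o g) w.
Proof.
elim: w => [|z w IH] /=; first exact: gmulf1.
by rewrite -IH; exact: gmulfM.
Qed.

(** Of the two implications between relators, one makes the map well defined and the other makes it
    injective. Reversing a word of involutions inverts it, so equality of two words is a relator. *)
Lemma word_morphism (G H : groupType) (g : gen -> G) (h : gen -> H) :
  (forall z, (g z * g z = 1)%g) -> (forall z, (h z * h z = 1)%g) ->
  (forall x, exists w, word_val g w = x) ->
  (forall w, word_val g w = 1%g <-> word_val h w = 1%g) ->
  exists f : {multiplicative G -> H}, injective f /\ forall z, f (g z) = h z.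
Proof.
move=> gK hK gS gh.
have ghE w w' : word_val g w = word_val g w' <-> word_val h w = word_val h w'.
  have E (K : groupType) (k : gen -> K) : (forall z, (k z * k z = 1)%g) ->
      word_val k w = word_val k w' <-> word_val k (w ++ rev w') = 1%g.
    move=> kK; rewrite word_val_cat word_val_rev //.
    by split=> [->|/divg1_eq//]; rewrite divgg.
  by rewrite !E.
have [f fE] := choice gS.
pose F x := word_val h (f x).
have FE w : F (word_val g w) = word_val h w by apply/ghE; rewrite fE.
have FM : {morph F : x y / (x * y)%g}.
  by move=> x y; rewrite -[x]fE -[y]fE -word_val_cat !FE word_val_cat.
pose FMm := isMultiplicative.Build G H F FM.
exists (HB.pack_for {multiplicative G -> H} F FMm); split=> [x y /=|z /=].
  by rewrite -[x]fE -[y]fE !FE => /ghE.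
by have := FE [:: z]; rewrite /= !mulg1.
Qed.

Definition grig_gen (z : gen) : grig omega01 :=
  match z with
  | ga => grig_a omega01
  | gc => grig_c omega01
  | gd => grig_d omega01
  end.

Lemma val_grig_gen z : val (grig_gen z) = grig_sym z. Proof. by case: z. Qed.

Lemma grig_symK z : (grig_sym z * grig_sym z = 1)%g.
Proof.
by apply: sym_ext => eta; rewrite sym_funM;
  case: z => /=; rewrite ?flipK ?spinalK.
Qed.

Lemma grig_word x : exists w, word_val grig_gen w = x.
Proof.
suff [w wE] : exists w, word_val grig_sym w = val x.
  exists w; apply: val_inj; rewrite val_word_val -wE; congr word_val.
  by apply/funext => z; exact: val_grig_gen.
case: x => x /= /asboolP gx.
pose words : {pred sym binseq} :=
  fun x => `[< exists w, word_val grig_sym w = x >].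
suff /asboolP : x \in words by []; apply: gx.
  split=> [|g h]; first by apply/asboolP; exists [::].
  move=> /asboolP[w <-] /asboolP[w' <-]; apply/asboolP.
  exists (w ++ rev w'); rewrite word_val_cat word_val_rev //.
  exact: grig_symK.
move=> s /set_mem[[[->|->]|->]|->]; apply/asboolP.
- by exists [:: ga]; rewrite /= mulg1.
- by exists [:: gc; gd]; rewrite /= mulg1 gen_bE.
- by exists [:: gc]; rewrite /= mulg1.
- by exists [:: gd]; rewrite /= mulg1.
Qed.

(** * Generalized 2-cycles in the topological full group *)

Section TwoCycle.
Variables (X : topologicalType) (T : sym X) (U : set X).

Lemma mem_imageT x : (x \in T @` U) = (sym_inv T x \in U).
Proof.
apply/idP/idP => [/set_mem[y Uy <-]|/set_mem Ux].
  by rewrite sym_funK; exact/mem_set.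
by apply/mem_set; exists (sym_inv T x); rewrite ?sym_invK.
Qed.

Lemma two_cycleK : T @` U `&` U = set0 -> involutive (two_cycle T U).
Proof.
move=> TU x; have disj y : y \in T @` U -> y \notin U.
  move=> /set_mem TUy; apply/negP => /set_mem Uy.
  by suff : (set0 : set X) y by []; rewrite -TU.
rewrite /two_cycle; case: (boolP (x \in U)) => xU.
  have TxU : T x \in T @` U by rewrite mem_imageT sym_funK.
  by rewrite (negbTE (disj _ TxU)) TxU sym_funK.
case: (boolP (x \in T @` U)) => xTU; last by rewrite (negbTE xU) (negbTE xTU).
by have := xTU; rewrite mem_imageT => ->; rewrite sym_invK.
Qed.

Lemma clopen_near (V : set X) x :
  clopen V -> \forall y \near x, (y \in V) = (x \in V).
Proof.
move=> Vc; case: (boolP (x \in V)) => xV.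
  have : nbhs x V by apply: open_nbhs_nbhs; split; [case: Vc|exact: set_mem].
  by apply: filterS => y Vy; exact: mem_set.
have : nbhs x (~` V).
  by apply: open_nbhs_nbhs; split;
    [case: (clopenC set0 Vc)|move=> /mem_set; exact/negP].
by apply: filterS => y Vy; apply/negbTE/negP => /set_mem.
Qed.

Lemma zexpg_continuous (k : int) :
  homeomorphism T -> continuous (zexpg T k : X -> X).
Proof.
move=> [Tc Tc']; suff H n : continuous ((T ^+ n)%g : X -> X) /\
    continuous ((T ^- n)%g : X -> X) by case: k => n; case: (H n); case: (H n.+1).
elim: n => [|n [IH IH']]; first by split=> x A.
rewrite expgSr; split=> x; first exact: (continuous_comp (Tc x) (IH _)).
rewrite invgM; exact: (continuous_comp (IH' x) (Tc' _)).
Qed.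

Lemma two_cycle_full_group : homeomorphism T -> two_cycle_dom T U ->
  exists2 F : full_group T, (forall x, val F x = two_cycle T U x) & (F * F = 1)%g.
Proof.
move=> Th [Uc TU]; pose F := sym_of_involution (two_cycleK TU).
pose nu x : discrete_topology int :=
  (if x \in U then 1 else if x \in T @` U then -1 else 0)%R.
have TUE : T @` U = sym_inv T @^-1` U.
  by apply/funext => x; rewrite -[LHS]in_setE mem_imageT in_setE.
have nuc x : \forall y \near x, nu y = nu x.
  have := clopen_near x Uc; have := clopen_near x (preimage_clopen Uc Th.2).
  by apply: filterS2 => y; rewrite /nu TUE => -> ->.
have FE x : F x = zexpg T (nu x) x.
  by rewrite /F /= /two_cycle /nu; case: ifP => // _; case: ifP.
(* Near x the exponent is constant, so [F] agrees there with a single power of [T]. *)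
have Fc : continuous F.
  move=> x; have : zexpg T (nu x) y @[y --> x] --> F x.
    by rewrite FE; exact: zexpg_continuous.
  apply: cvg_trans; apply: near_eq_cvg.
  by apply: filterS (nuc x) => y nuy; rewrite FE nuy.
have Ffull : in_full_group T F.
  by apply/asboolP; split=> //; exists nu => //; exact/continuous_discreteP.
exists (exist _ F Ffull) => //; apply: val_inj; apply: sym_ext => x.
exact: two_cycleK.
Qed.

End TwoCycle.

(** * Walks on the integers along labelled edges *)

Section Walk.
Local Open Scope ring_scope.

Definition step (P : int -> bool) (v : int) : int :=
  if P v then v + 1 else if P (v - 1) then v - 1 else v.

Definition walk (P : gen -> int -> bool) (w : seq gen) (v : int) : int :=
  foldr (fun z => step (P z)) v w.

(** Each letter moves by at most one and looks only at the two edges meeting at the current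
    position. *)
Lemma walk_local P P' w v v' :
  (forall z i, (`|i| <= size w)%N -> P z (v + i) = P' z (v' + i)) ->
  (`|walk P w v - v| <= size w)%N /\ walk P' w v' - v' = walk P w v - v.
Proof.
elim: w => [|z w IH] PP'; first by rewrite /= !subrr.
have [|d_le dE] := IH; first by move=> y i iw; apply: PP' => /=; lia.
move: d_le dE => /=; set u := walk P w v; set u' := walk P' w v' => d_le dE.
have Pd i : (`|i| <= 1)%N -> P z (u + i) = P' z (u' + i).
  have [-> ->] : u + i = v + (u - v + i) /\ u' + i = v' + (u - v + i) by lia.
  by move=> i1; apply: PP' => /=; lia.
rewrite /step -[in P z u](addr0 u) -[in P' z u'](addr0 u') !Pd //.
by case: ifP => _; [lia|case: ifP => _; lia].
Qed.

(* Seen inside the integers: the negative positions carry no edge, so that 0 is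
   the end of the half-line. *)
Definition half_edge (z : gen) (v : int) : bool :=
  if v is Posz n then edge z (fun i => xi_pd (n + i)) else false.

Lemma walk_gray w (n : nat) : exists2 n' : nat,
  walk half_edge w n%:Z = n'%:Z & word_val grig_sym w (gray n) = gray n'.
Proof.
elim: w => [|z w [m /= -> IH]]; first by exists n.
exists (step_nat (fun n => edge z (fun i => xi_pd (n + i)%N)) m).
  rewrite /step /step_nat /=; case: ifP => _; first by lia.
  case: m {IH} => [//|m]; have -> : m.+1%:Z - 1 = m%:Z by lia.
  by rewrite /=; case: ifP.
by rewrite IH grig_sym_gray.
Qed.

Definition edges (u : int -> letter) (z : gen) (v : int) : bool :=
  edge z (fun i => u (v + i%:Z)).

End Walk.

(** * Windows and two-sided points of the subshifts *)

Section Subshifts.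
Local Open Scope ring_scope.

Lemma walk_half_edge w n : word_val grig_sym w = 1%g ->
  walk half_edge w n%:Z = n%:Z.
Proof.
move=> w1; have [n' ->] := walk_gray w n.
by rewrite w1 => /gray_inj->.
Qed.

Lemma OmegaP (A : finType) (xi : nat -> A) (s : fullshift A) :
  Omega xi s <-> forall (k : int) (N : nat), exists m : nat,
    forall i, (i < N)%N -> s (k + i%:Z) = xi (m + i)%N.
Proof.
split=> [xis k N|H w _ [k wE]]; last first.
  have [m mE] := H k (size w); exists m; rewrite [LHS]wE.
  apply: (@eq_from_nth _ (xi 0%N)); rewrite !size_mkseq // => i iw.
  by rewrite !nth_mkseq // mE.
(* The length is N + 1, because [Omega] constrains nonempty words only. *)
have [] := xis (mkseq (fun i : nat => s (k + i%:Z)) N.+1).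
- by rewrite -size_eq0 size_mkseq.
- by exists k; rewrite size_mkseq.
move=> m; rewrite size_mkseq => mE; exists m => i iN.
have := congr1 (nth (xi 0%N) ^~ i) mE.
by rewrite /= !nth_mkseq // ltnS ltnW.
Qed.

Lemma walk_Omega (s : fullshift letter) w v : Omega xi_pd s ->
  word_val grig_sym w = 1%g -> walk (edges s) w v = v.
Proof.
move=> /OmegaP xs w1.
(* The 2 [size w] + 1 positions within reach of v, and three more letters since [edge] reads
   four. *)
have [m mE] := xs (v - (size w)%:Z) (size w + size w + 4)%N.
have [z i iw|_] := @walk_local (edges s) half_edge w v (m + size w)%N%:Z.
  have -> : (m + size w)%N%:Z + i = (m + `|((size w)%:Z + i)%R|)%N by lia.
  rewrite /half_edge /edges.
  have sE j : (j < 4)%N ->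
      s (v + i + j%:Z) = xi_pd (m + `|((size w)%:Z + i)%R| + j)%N.
    move=> j4; rewrite -addnA -mE; last by lia.
    by congr s; lia.
  by case: z; rewrite /edge !sE.
by rewrite walk_half_edge // subrr => /esym/subr0_eq.
Qed.

Definition differences (t : int -> bool) (n : int) : letter :=
  if t n != t (n + 1) then lx else ly.

Lemma differences_Omega (t : fullshift bool) :
  Omega xi_TM t -> Omega xi_pd (differences t).
Proof.
move=> /OmegaP xt; apply/OmegaP => k N; have [m mE] := xt k N.+1.
exists m => i iN; rewrite /differences xi_pd_TM -addnS -!mE; [|lia|lia].
by rewrite -addrA -addn1.
Qed.

Local Open Scope nat_scope.

(** [xi_TM] is the parity of the binary digit sum, and this addition has no carries. *)
Lemma xi_TM_addM m k r : r < 2 ^ m -> xi_TM (k * 2 ^ m + r) = xi_TM k (+) xi_TM r.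
Proof.
elim: m r => [|m IH] r.
  by rewrite expn0 ltnS leqn0 muln1 => /eqP->; rewrite addn0 xi_TM0 addbF.
rewrite expnS; case: (nat_parity r) => -[q ->] rm.
  have -> : k * (2 * 2 ^ m) + q.*2 = (k * 2 ^ m + q).*2 by lia.
  by rewrite !xi_TM_double IH //; lia.
have -> : k * (2 * 2 ^ m) + q.*2.+1 = (k * 2 ^ m + q).*2.+1 by lia.
by rewrite !xi_TM_doubleS IH ?addbN //; lia.
Qed.

(** The reflection complements each of the m binary digits of r. *)
Lemma xi_TM_reflect m r : r < 2 ^ m -> xi_TM (2 ^ m - r.+1) = xi_TM r (+) odd m.
Proof.
elim: m r => [|m IH] r; first by case: r => // _; rewrite xi_TM0.
rewrite expnS; case: (nat_parity r) => -[q ->] rm.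
  have -> : 2 * 2 ^ m - q.*2.+1 = (2 ^ m - q.+1).*2.+1 by lia.
  by rewrite xi_TM_double xi_TM_doubleS IH ?addbN //; lia.
have -> : 2 * 2 ^ m - q.*2.+2 = (2 ^ m - q.+1).*2 by lia.
by rewrite xi_TM_double xi_TM_doubleS IH /= ?addNb ?addbN ?negbK //; lia.
Qed.

(* The Thue-Morse word and its mirrored complement meet around position 3 * 4^m
   of the Thue-Morse word, because its terms 2 and 3 are 1 and 0. *)
Definition two_sided_TM (n : int) : bool :=
  match n with Posz k => xi_TM k | Negz k => ~~ xi_TM k end.

Lemma two_sided_TM_Omega : Omega xi_TM (two_sided_TM : fullshift bool).
Proof.
apply/OmegaP => k N; set K := `|k|%N + N.
(* A power of 4 exceeding the window: the exponent is even, so [xi_TM_reflect] preserves letters. *)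
have K2 : K < 2 ^ K.*2.
  by apply: leq_trans (ltn_expl _ (ltnSn 1)) _; rewrite leq_exp2l; lia.
have tm2 : xi_TM 2 = true by rewrite (xi_TM_double 1) (xi_TM_doubleS 0) xi_TM0.
have tm3 : xi_TM 3 = false by rewrite (xi_TM_doubleS 1) (xi_TM_doubleS 0) xi_TM0.
exists `|((3 * 2 ^ K.*2)%N%:Z + k)%R| => i iN.
case E : (k + i%:Z)%R => [n|n] /=.
  have -> : `|((3 * 2 ^ K.*2)%N%:Z + k)%R| + i = 3 * 2 ^ K.*2 + n by lia.
  by rewrite xi_TM_addM ?tm3 //; lia.
have -> : `|((3 * 2 ^ K.*2)%N%:Z + k)%R| + i =
    2 * 2 ^ K.*2 + (2 ^ K.*2 - n.+1) by lia.
rewrite xi_TM_addM ?tm2; last by lia.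
by rewrite xi_TM_reflect ?odd_double ?addbF //; lia.
Qed.

End Subshifts.

(** * The embedding argument common to both subshifts *)

Section Embedding.
(** [code] reads the edge labels off a point: it is the identity for period doubling and
    [differences] for Thue-Morse. *)
Variables (A : finType) (xi : nat -> A) (code : fullshift A -> int -> letter).
Variable U : gen -> set (fullshift A).
Hypothesis code_translate : forall k s n, code (translate k s) n = code s (n + k)%R.
Hypothesis code_Omega : forall s, Omega xi s -> Omega xi_pd (code s).
Hypothesis code_xi_pd :
  exists2 s, Omega xi s & forall n : nat, code s n%:Z%R = xi_pd n.
Hypothesis U_clopen : forall z, clopen (U z).
Hypothesis U_code : forall z s, U z s <-> edges (code s) z 1%R.

Local Notation T := (Omega_shift xi).
Local Notation V z := (set_val @^-1` (U z) : set (Omega xi)).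
Local Open Scope ring_scope.

Lemma Omega_ext (x y : Omega xi) : (forall n, set_val x n = set_val y n) -> x = y.
Proof. by move=> xy; apply: val_inj; apply/funext => n; rewrite -!set_valE. Qed.

Lemma translateO0 (x : Omega xi) : translateO 0 x = x.
Proof. by apply: Omega_ext => n; rewrite -[LHS]/(set_val x (n + 0)) addr0. Qed.

Lemma translateOD k l (x : Omega xi) :
  translateO k (translateO l x) = translateO (k + l) x.
Proof.
apply: Omega_ext => n; rewrite -[LHS]/(set_val x (n + k + l)).
by rewrite -[RHS]/(set_val x (n + (k + l))) addrA.
Qed.

Lemma edges_translate k s z v :
  edges (code (translate k s)) z v = edges (code s) z (v + k).
Proof.
congr edge; apply/funext => i.
by rewrite code_translate addrAC.
Qed.

Lemma mem_V z (x : Omega xi) : (x \in V z) = edges (code (set_val x)) z 1.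
Proof. by apply/idP/idP => [/set_mem/U_code|/U_code/mem_set]. Qed.

Lemma two_cycle_step z x :
  two_cycle T (V z) x = translateO (step (edges (code (set_val x)) z) 1 - 1) x.
Proof.
rewrite /two_cycle mem_imageT !mem_V /=.
rewrite -[set_val (translateO _ _)]/(translate (-1) (set_val x)).
rewrite edges_translate /step; do 2!case: ifP => // _.
by rewrite subrr translateO0.
Qed.

(** Disjointness says that adjacent edges never share a label. For [ga] and [gd] the tested words
    clash when shifted by one; for [gc], one of two adjacent positions of [xi_pd] is even and
    carries x. *)
Lemma two_cycle_dom_V z : two_cycle_dom T (V z).
Proof.
split.
  by apply: preimage_clopen (U_clopen z) _; exact: initial_continuous.
rewrite -subset0 => x [TVx Vx].
have : x \in T @` V z by exact/mem_set.
have : x \in V z by exact/mem_set.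
rewrite mem_imageT !mem_V.
rewrite -[set_val (sym_inv _ _)]/(translate (-1) (set_val x)) edges_translate.
have xO := code_Omega (set_valP x); rewrite /edges.
have shift1 i : code (set_val x) (1 - 1 + i.+1%:Z) = code (set_val x) (1 + i%:Z).
  by congr (code _ _); lia.
case: z {TVx Vx} => /=; rewrite !shift1.
- by move=> /orP[/andP[/eqP-> /eqP->]|/and4P[/eqP-> /eqP-> /eqP-> _]];
    rewrite /= ?andbF.
- rewrite -(shift1 0%N).
  have [m mE] := (OmegaP _ _).1 xO (1 - 1) 2%N.
  rewrite !mE // addn0 addn1.
  have [om|em] := boolP (odd m); last by rewrite [xi_pd m]xi_pd_even.
  by rewrite [xi_pd m.+1]xi_pd_even //= negbK.
- by move=> /and3P[_ /eqP-> _]; rewrite /= !andbF.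
Qed.

Lemma full_group_gen z : exists2 F : full_group T,
  is_two_cycle (V z) F & (F * F = 1)%g.
Proof.
have [F FE FF] := two_cycle_full_group (@Omega_shift_homeomorphism _ xi)
  (two_cycle_dom_V z).
by exists F => //; split=> //; exact: two_cycle_dom_V.
Qed.

(** The walk starts at 1 because cylinders read letters from x_1 on; each 2-cycle moves the dot one
    step along the labels of the initial point. *)
Lemma two_cycle_word (F : gen -> full_group T) w x :
  (forall z, is_two_cycle (V z) (F z)) ->
  val (word_val F w) x = translateO (walk (edges (code (set_val x))) w 1 - 1) x.
Proof.
move=> FU; rewrite val_word_val; elim: w => [|z w IH] /=.
  by rewrite subrr translateO0.
rewrite IH (FU z).2 two_cycle_step.
set v := walk _ _ _.
rewrite -[set_val (translateO _ _)]/(translate (v - 1) (set_val x)).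
rewrite translateOD; congr translateO; rewrite /step !edges_translate.
have -> : 1 + (v - 1) = v by lia.
have -> : 1 - 1 + (v - 1) = v - 1 by lia.
by case: ifP => _; [lia|case: ifP => _; lia].
Qed.

Lemma relator_transfer (F : gen -> full_group T) w :
  (forall z, is_two_cycle (V z) (F z)) ->
  word_val grig_gen w = 1%g <-> word_val F w = 1%g.
Proof.
move=> FU; have grig1 : word_val grig_gen w = 1%g <-> word_val grig_sym w = 1%g.
  have <- : val (word_val grig_gen w) = word_val grig_sym w.
    rewrite val_word_val; congr word_val; apply/funext => z.
    exact: val_grig_gen.
  by split=> [->|e] //; apply: val_inj.
rewrite grig1; split=> [w1|F1].
  apply: val_inj; apply: sym_ext => x; rewrite two_cycle_word //.
  rewrite walk_Omega //; last exact/code_Omega/set_valP.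
  by rewrite subrr translateO0.
have [s sO sE] := code_xi_pd.
(* If the walk moved v by d, translation by d would fix s, so |d| would be a period of [xi_pd];
   hence d = 0. *)
have walk_s v : walk (edges (code s)) w v = v.
  pose x : Omega xi := translateO (v - 1) (exist _ s (mem_set sO)).
  have xE : code (set_val x) = code (translate (v - 1) s) by [].
  have [z i _|_ wE] := @walk_local (edges (code s))
      (edges (code (set_val x))) w v 1.
    by rewrite xE edges_translate; congr (edges _ _ _); lia.
  have := two_cycle_word w x FU; rewrite F1 wE /=.
  set d := _ - v => xd.
  have sd n : s n = s (n + d).
    have := congr1 (fun y => set_val y (n - (v - 1))) xd.
    rewrite -[X in X = _]/(s (n - (v - 1) + (v - 1))) subrK => ->.
    rewrite -[X in X = _]/(s (n - (v - 1) + d + (v - 1))); congr s; lia.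
  have cd n : code s (n + d) = code s n.
    rewrite -code_translate; congr (code _ n); apply/funext => m.
    by rewrite sd.
  have d0 : `|d|%N = 0%N.
    apply: (@xi_pd_aperiodic _ 0) => n _; rewrite -!sE PoszD.
    have [d_ge0|d_lt0] : 0 <= d \/ d < 0 by lia.
      by rewrite -[in RHS]cd; congr (code s); lia.
    by rewrite -[LHS]cd; congr (code s); lia.
  by rewrite /d in d0; lia.
(* From n at least [size w] the walk sees only nonnegative positions, where [code s] is [xi_pd]. *)
have walk_half n : (size w <= n)%N -> walk half_edge w n%:Z = n%:Z.
  move=> wn; have [z i iw|_] := @walk_local (edges (code s)) half_edge w n%:Z n%:Z.
    have -> : n%:Z + i = `|(n%:Z + i)%R|%N by lia.
    rewrite /half_edge /edges; congr edge; apply/funext => j.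
    by rewrite -PoszD sE.
  by rewrite walk_s subrr => /subr0_eq.
apply: sym_ext => eta; apply/funext => k.
have [n wn nE] := gray_dense eta (size w) k.+1.
have [n' nn' wE] := walk_gray w n.
have n'E : n' = n by have := walk_half n wn; rewrite nn' => -[].
have prefix m : forall u v : binseq, (forall k, (k < m)%N -> u k = v k) ->
    forall k, (k < m)%N -> word_val grig_sym w u k = word_val grig_sym w v k.
  elim: (w) => [|z w' IH] u v uv //=.
  by apply: grig_sym_prefix; exact: IH.
rewrite -(prefix k.+1 (gray n) eta) //.
by rewrite wE n'E nE.
Qed.

Theorem grig_embedding :
  exists h : {multiplicative grig omega01 -> full_group T},
    injective h /\ forall z, is_two_cycle (V z) (h (grig_gen z)).
Proof.
have [F FE] := choice (fun z =>
  let: ex_intro2 F FU FK := full_group_gen z in ex_intro _ F (conj FU FK)).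
have FU z := (FE z).1.
have gK z : (grig_gen z * grig_gen z = 1)%g.
  apply: val_inj; rewrite -[RHS](grig_symK z) -val_grig_gen; exact: gmulfM.
have [h [h_inj hE]] := word_morphism gK (fun z => (FE z).2) grig_word
  (fun w => relator_transfer w FU).
by exists h; split=> // z; rewrite hE.
Qed.

End Embedding.

(** * Cylinders and the two embeddings *)

Lemma cylinder_clopen (A : finType) (w : seq A) : clopen (cylinder w).
Proof.
pose prefix (s : fullshift A) : discrete_topology (seq A) :=
  mkseq (fun i : nat => s i.+1%:Z%R) (size w).
have -> : cylinder w = prefix @^-1` [set w].
  by apply/funext => s; apply/propext; split=> /esym.
apply: preimage_clopen.
  by split; [exact: discrete_open|exact: discrete_closed].
suff near_prefix n (s : fullshift A) : \forall t \near s,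
    mkseq (fun i : nat => t i.+1%:Z%R) n = mkseq (fun i : nat => s i.+1%:Z%R) n.
  by apply/continuous_discreteP => s; exact: near_prefix.
have F : Filter (nbhs s) by exact: nbhs_filter.
elim: n => [|n IH]; first exact: (@filterE _ (nbhs s)).
have sn : \forall t \near s, t n.+1%:Z%R = s n.+1%:Z%R.
  have := @proj_continuous _ (fun=> discrete_topology A) n.+1%:Z%R s.
  exact (fun c => c _ (discrete_set1 (s n.+1%:Z%R : discrete_topology A))).
by apply: (filterS2 F _ IH sn) => t; rewrite !mkseqS => -> ->.
Qed.

Lemma cylinderE (A : finType) (w : seq A) (s : fullshift A) :
  cylinder w s = (w == mkseq (fun i : nat => s (1 + i%:Z)%R) (size w)) :> Prop.
Proof. by apply/propext; rewrite -(rwP eqP). Qed.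

Theorem proposition5p15 :
  (exists h1 : {multiplicative (grig omega01) -> (full_group (Omega_shift xi_pd))},
    let U_a := cylinder [:: lx; ly] `|` cylinder [:: lx; lx; lx; ly] in
    let U_c := cylinder [:: ly] in
    let U_d := cylinder [:: lx; lx; ly] in
    [/\ injective h1,
        is_two_cycle (set_val @^-1` U_a) (h1 (grig_a omega01)),
        is_two_cycle (set_val @^-1` U_c) (h1 (grig_c omega01)) &
        is_two_cycle (set_val @^-1` U_d) (h1 (grig_d omega01))])
  /\
  (exists h2 : {multiplicative (grig omega01) -> (full_group (Omega_shift xi_TM))},
    let o := false in
    let i := true in
    let W_a := cylinder [:: o; i; i] `|` cylinder [:: i; o; o]
               `|` cylinder [:: o; i; o; i; i]
               `|` cylinder [:: i; o; i; o; o] in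
    let W_c := cylinder [:: o; o] `|` cylinder [:: i; i] in
    let W_d := cylinder [:: o; i; o; o] `|` cylinder [:: i; o; i; i] in
    [/\ injective h2,
        is_two_cycle (set_val @^-1` W_a) (h2 (grig_a omega01)),
        is_two_cycle (set_val @^-1` W_c) (h2 (grig_c omega01)) &
        is_two_cycle (set_val @^-1` W_d) (h2 (grig_d omega01))]).
Proof.
have TM := two_sided_TM_Omega.
have pd (n : nat) : differences two_sided_TM n%:Z%R = xi_pd n.
  by rewrite xi_pd_TM /differences -PoszD addn1.
split.
- pose U z : set (fullshift letter) := match z with
    | ga => cylinder [:: lx; ly] `|` cylinder [:: lx; lx; lx; ly]
    | gc => cylinder [:: ly]
    | gd => cylinder [:: lx; lx; ly]
    end.
  have [|||||h [h_inj hU]] := @grig_embedding _ xi_pd (fun s => s) U => //.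
  + by exists (differences two_sided_TM); first exact: differences_Omega.
  + by case; [apply: clopenU|..]; exact: cylinder_clopen.
  (* Both sides depend on at most four letters, so all cases are checked. *)
  + case=> s; rewrite /U /setU /mkset ?cylinderE ?(rwP orP) /edges /mkseq /=;
      move: (s (1 + 0%:Z)%R) (s (1 + 1%:Z)%R); do ?move: (s (1 + _%:Z)%R);
      by do ?case; split.
  exists h; split=> //; [exact: (hU ga)|exact: (hU gc)|exact: (hU gd)].
- pose W z : set (fullshift bool) := match z with
    | ga => cylinder [:: false; true; true] `|` cylinder [:: true; false; false]
            `|` cylinder [:: false; true; false; true; true]
            `|` cylinder [:: true; false; true; false; false]
    | gc => cylinder [:: false; false] `|` cylinder [:: true; true]
    | gd => cylinder [:: false; true; false; false]
            `|` cylinder [:: true; false; true; true]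
    end.
  have [|||||h [h_inj hW]] := @grig_embedding _ xi_TM differences W.
  + by move=> k s n; rewrite /differences /translate addrAC.
  + exact: differences_Omega.
  + by exists two_sided_TM.
  + by case; do ?apply: clopenU; exact: cylinder_clopen.
  + have dE s i : differences s (1 + i%:Z)%R =
        if s (1 + i%:Z)%R != s (1 + i.+1%:Z)%R then lx else ly.
      by rewrite /differences -addrA intS [(i%:Z + 1)%R]addrC.
    (* Differences send 011 and 100 to xy, 01011 and 10100 to xxxy, 00 and 11 to y, 0100 and 1011 to
       xxy. *)
    case=> s; rewrite /W /setU /mkset !cylinderE !(rwP orP) /edges /mkseq /= !dE;
      move: (s (1 + 0%:Z)%R) (s (1 + 1%:Z)%R); do ?move: (s (1 + _%:Z)%R);
      by do ?case; split.
  exists h; split=> //; [exact: (hW ga)|exact: (hW gc)|exact: (hW gd)].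
Qed.
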